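(* Let $0<\alpha<1$. Then the Chebyshev polynomial hypergroup of the second kind is not an $\alpha$-Ramsey hypergroup.
   Context: The Chebyshev polynomial hypergroup of the second kind is $\mathbb{Z}_+$ with identity $0$, identity involution, and convolution $\delta_m*\delta_n=\sum_{k=0}^{\min\{m,n\}}\frac{|m-n|+2k+1}{(m+1)(n+1)}\delta_{|m-n|+2k}$ (extended bilinearly). For an infinite discrete hypergroup $K$ with identity $e$, an injective sequence $\langle x_n\rangle$ in $K\setminus\{e\}$ with range $B$, and nonempty finite $F=\{x_{n_1},\dots,x_{n_m}\}\subset B$ with $n_1<\dots<n_m$, put $\delta_F=\delta_{x_{n_1}}*\cdots*\delta_{x_{n_m}}$. For $0\le\alpha<1$, $K$ is an $\alpha$-Ramsey hypergroup if for every finite partition $K=\bigcup_{i=1}^rC_i$ there exist $i$ and an injective sequence $\langle x_n\rangle$ in $K\setminus\{e\}$ with range $B$ such that $\delta_F(C_i)>\alpha$ for every nonempty finite $F\subset B$. *)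

(* Defs.v *)
From HB Require Import structures.
From mathcomp Require Import all_boot all_order all_algebra finmap.
From mathcomp Require Import boolp classical_sets reals.
From mathcomp Require Import monalg.
From mathcomp Require Import ring lra zify.

Set Implicit Arguments.
Unset Strict Implicit.
Unset Printing Implicit Defensive.

Import Order.TTheory GRing.Theory Num.Theory.

Local Open Scope ring_scope.

(* Finitely supported real measures on a discrete space K are elements of     *)
(* {malg R[K]}: << x >> is the point mass at x and f@_x the mass of {x}.      *)

Definition measure_of (R : realType) (K : choiceType)
    (f : {malg R[K]}) (A : set K) : R :=
  \sum_(x <- msupp f | x \in A) f@_x.

Definition bilin_ext (R : realType) (K : choiceType)
    (c : K -> K -> {malg R[K]}) (f g : {malg R[K]}) : {malg R[K]} :=
  \sum_(x <- msupp f) \sum_(y <- msupp g) (f@_x * g@_y) *: c x y.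

(* A discrete hypergroup: the topological axioms of a general hypergroup are  *)
(* automatic on a discrete space once the supports are finite.                *)
Record hypergroup (R : realType) := Hypergroup {
  hg_sort :> choiceType;
  hg_one : hg_sort;
  hg_inv : hg_sort -> hg_sort;
  hg_conv : hg_sort -> hg_sort -> {malg R[hg_sort]};
  hg_conv_ge0 : forall x y z, 0 <= (hg_conv x y)@_z;
  hg_conv_mass1 : forall x y, measure_of (hg_conv x y) setT = 1;
  hg_convA : associative (bilin_ext hg_conv);
  hg_conv1x : forall x, hg_conv hg_one x = << x >>;
  hg_convx1 : forall x, hg_conv x hg_one = << x >>;
  hg_invK : involutive hg_inv;
  hg_inv_conv : forall x y z,
    (hg_conv x y)@_(hg_inv z) = (hg_conv (hg_inv y) (hg_inv x))@_z;
  hg_one_supp : forall x y,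
    (hg_one \in msupp (hg_conv x y)) = (y == hg_inv x)
}.

Definition mconv (R : realType) (K : hypergroup R) :
    {malg R[K]} -> {malg R[K]} -> {malg R[K]} :=
  bilin_ext (@hg_conv R K).

(* delta_x1 * ... * delta_xm for s = [:: x1; ...; xm]; since hg_one is the    *)
(* identity, the neutral final factor << hg_one K >> is harmless.             *)
Definition delta_prod (R : realType) (K : hypergroup R) (s : seq K) :
    {malg R[K]} :=
  \big[@mconv R K / << hg_one K >>]_(y <- s) << y >>.

(* The nonempty finite subsets F of the range of the injective sequence x are *)
(* indexed by the nonempty strictly increasing lists s = [:: n_1; ...; n_m]   *)
(* via F = {x n_1, ..., x n_m}.                                               *)
Definition alpha_Ramsey (R : realType) (alpha : R) (K : hypergroup R) : Prop :=
  forall (r : nat) (C : 'I_r -> set K),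
    classical_sets.partition setT C setT ->
    exists (i : 'I_r) (x : nat -> K),
      [/\ injective x,
          forall n, x n != hg_one K &
          forall s : seq nat, s != [::] -> sorted ltn s ->
            alpha < measure_of (delta_prod [seq x n | n <- s]) (C i)].

Definition chebyshev2_conv (R : realType) (m n : nat) : {malg R[nat]} :=
  \sum_(k < (minn m n).+1)
    << ((`|m - n|%N + 2 * k + 1)%:R / ((m + 1)%:R * (n + 1)%:R))
       *g (`|m - n|%N + 2 * k)%N >>.

Section Chebyshev2.
Variable R : realType.

Local Notation conv := (@chebyshev2_conv R).

Lemma chebyshev2_convC m n : conv m n = conv n m.
Proof.
by rewrite /chebyshev2_conv minnC distnC mulrC.
Qed.

(* The monic rescaling V_n(X) = U_n(X/2) of the Chebyshev polynomials of the  *)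
(* second kind; V_n / (n + 1) linearizes the convolution.                     *)
Fixpoint monic_chebyshev2 (n : nat) : {poly R} :=
  match n with
  | 0 => 1
  | n'.+1 => if n' is n''.+1
             then 'X * monic_chebyshev2 n' - monic_chebyshev2 n''
             else 'X
  end.
Local Notation V := monic_chebyshev2.

Lemma monic_chebyshev2SS n : V n.+2 = 'X * V n.+1 - V n.
Proof. by []. Qed.

Lemma mulX_monic_chebyshev2 n : 'X * V n.+1 = V n.+2 + V n.
Proof. by rewrite monic_chebyshev2SS subrK. Qed.

Lemma monic_chebyshev2_monic n : V n \is monic /\ size (V n) = n.+1.
Proof.
suff [] : (V n \is monic /\ size (V n) = n.+1) /\
          (V n.+1 \is monic /\ size (V n.+1) = n.+2) by [].
elim: n => [|n [[mn sn] [mSn sSn]]].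
  by rewrite /= monic1 size_poly1 monicX size_polyX.
have sX : size ('X * V n.+1) = n.+3.
  by rewrite mulrC size_mulX ?monic_neq0 // sSn.
have lt : (size (- V n) < size ('X * V n.+1)%R)%N by rewrite size_polyN sX sn.
split=> //; rewrite monic_chebyshev2SS; split.
  by rewrite monicE lead_coefDl // lead_coef_Mmonic ?lead_coefX // monicX.
by rewrite size_polyDl.
Qed.

Arguments monic_chebyshev2 : simpl never.

Lemma monic_chebyshev2_mul m d :
  V m * V (m + d)%N = \sum_(k < m.+1) V (d + 2 * k)%N.
Proof.
suff [] : (forall d, V m * V (m + d)%N = \sum_(k < m.+1) V (d + 2 * k)%N) /\
  (forall d, V m.+1 * V (m.+1 + d)%N = \sum_(k < m.+2) V (d + 2 * k)%N) by [].
elim: m {d} => [|m [IHm IHSm]].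
  split=> d; first by rewrite add0n big_ord1 mul1r muln0 addn0.
  rewrite add1n mulX_monic_chebyshev2 addrC !big_ord_recr big_ord0 /= add0r.
  by congr (V _ + V _); lia.
split=> // d; rewrite monic_chebyshev2SS mulrBl -mulrA.
have -> : (m.+2 + d = m.+1 + d.+1)%N by lia.
rewrite IHSm; have -> : (m.+1 + d.+1 = m + d.+2)%N by lia.
rewrite IHm mulr_sumr.
rewrite (eq_bigr (fun k : 'I__ => V (d.+2 + 2 * k)%N + V (d + 2 * k)%N));
  last by move=> k _; rewrite addSn mulX_monic_chebyshev2.
rewrite big_split /= big_ord_recr /= [in RHS]big_ord_recr /=.
have -> : (d + 2 * m.+2 = d.+2 + 2 * m.+1)%N by lia.
by ring.
Qed.

Definition normalized_chebyshev2 (n : nat) : {poly R} :=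
  (n + 1)%:R^-1 *: V n.
Local Notation h := normalized_chebyshev2.

Definition chebyT (f : {malg R[nat]}) : {poly R} :=
  \sum_(k <- msupp f) f@_k *: h k.
Local Notation phi := chebyT.

Lemma chebyTE f : phi f = mmap (polyC : R -> {poly R}) h f.
Proof. rewrite mmapE /phi; apply: eq_bigr => k _. exact/esym/mul_polyC. Qed.

Lemma chebyT_sum (I : Type) (r : seq I) P (F : I -> {malg R[nat]}) :
  phi (\sum_(i <- r | P i) F i) = \sum_(i <- r | P i) phi (F i).
Proof. by rewrite chebyTE raddf_sum; apply: eq_bigr => i _; rewrite chebyTE. Qed.

Lemma chebyTU c k : phi << c *g k >> = c *: h k.
Proof. by rewrite chebyTE mmapU mul_polyC. Qed.

Lemma chebyTZ c f : phi (c *: f) = c *: phi f.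
Proof.
rewrite malgZ_def /fgscale chebyT_sum [in RHS]/phi scaler_sumr.
by apply: eq_bigr => k _; rewrite chebyTU [RHS]scalerA.
Qed.

Lemma chebyT_conv m n : phi (conv m n) = h m * h n.
Proof.
wlog le_mn : m n / (m <= n)%N => [hw|].
  case/orP: (leq_total m n) => /hw // e.
  by rewrite chebyshev2_convC e mulrC.
rewrite /chebyshev2_conv chebyT_sum (minn_idPl le_mn).
have -> : `|m - n|%N = (n - m)%N by rewrite distnEr.
rewrite /h -scalerAl -scalerAr scalerA.
have := monic_chebyshev2_mul m (n - m); rewrite subnKC // => ->.
rewrite scaler_sumr; apply: eq_bigr => k _.
rewrite chebyTU /h scalerA; congr (_ *: _).
by rewrite mulrAC mulfV ?mul1r ?invfM // pnatr_eq0 addn1.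
Qed.

Lemma chebyT_bilin_ext f g : phi (bilin_ext conv f g) = phi f * phi g.
Proof.
rewrite chebyT_sum [X in _ = X * _]/phi mulr_suml; apply: eq_bigr => x _.
rewrite chebyT_sum [X in _ = _ * X]/phi -scalerAl mulr_sumr scaler_sumr; apply: eq_bigr => y _.
by rewrite chebyTZ chebyT_conv -[in RHS]scalerAr [RHS]scalerA.
Qed.

Lemma chebyT_eq0 f : phi f = 0 -> f = 0.
Proof.
suff small N : (forall k, (N <= k)%N -> f@_k = 0) -> phi f = 0 -> f = 0.
  apply: (small (\max_(k <- msupp f) k).+1) => k ltk.
  apply/eqP; rewrite mcoeff_eq0; apply/negP => kf.
  have := @leq_bigmax_seq _ _ xpredT (fun n : nat => n) k kf isT.
  by rewrite leqNgt ltk.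
elim: N => [|N IH] z p0; first by apply/malgP => k; rewrite z // mcoeff0.
apply: IH => // k; rewrite leq_eqVlt => /predU1P[<-|]; last exact: z.
have : (phi f)`_N = 0 by rewrite p0 coef0.
have [Nf|//] := msuppP f N.
rewrite /phi coef_sum (big_fsetD1 N) //= coefZ big1_fset => [|j]; last first.
  rewrite in_fsetD1 => /andP[jN jf] _.
  have ltjN : (j < N)%N.
    rewrite ltn_neqAle jN leqNgt; apply/negP => /z /eqP.
    by rewrite mcoeff_eq0 jf.
  rewrite coefZ /h coefZ [X in _ * (_ * X)]nth_default ?mulr0 //.
  by rewrite (monic_chebyshev2_monic j).2.
have [mN sN] := monic_chebyshev2_monic N.
have -> : (h N)`_N = (N + 1)%:R^-1.
  by rewrite coefZ; move/monicP: mN; rewrite lead_coefE sN => ->; rewrite mulr1.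
rewrite addr0 => /eqP; rewrite mulf_eq0 invr_eq0 pnatr_eq0 addn1 orbF.
by move/eqP.
Qed.

Lemma chebyT_inj : injective phi.
Proof.
move=> f g e; apply/eqP; rewrite -subr_eq0; apply/eqP/chebyT_eq0.
by rewrite chebyTE raddfB /= -!chebyTE e subrr.
Qed.

Lemma chebyshev2_convA : associative (bilin_ext conv).
Proof. by move=> f g k; apply: chebyT_inj; rewrite !chebyT_bilin_ext mulrA. Qed.

Lemma chebyshev2_conv_ge0 m n z : 0 <= (conv m n)@_z.
Proof.
rewrite raddf_sum sumr_ge0 // => k _.
by rewrite /= mcoeffU mulrn_wge0 // divr_ge0 // ?mulr_ge0.
Qed.

Lemma measure_ofT (f : {malg R[nat]}) :
  measure_of f setT = mmap (idfun : R -> R) (fun=> 1) f.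
Proof. by apply: eq_big => [k|k _]; rewrite ?in_setT ?mulr1. Qed.

Lemma sum_odd_shift m d :
  (\sum_(k < m.+1) (d + 2 * k + 1) = (m + 1) * (m + d + 1))%N.
Proof.
elim: m => [|m IH]; first by rewrite big_ord1 /=; lia.
by rewrite big_ord_recr /= IH; nia.
Qed.

Lemma chebyshev2_conv_mass1 m n : measure_of (conv m n) setT = 1.
Proof.
wlog le_mn : m n / (m <= n)%N => [hw|].
  case/orP: (leq_total m n) => /hw // e.
  by rewrite chebyshev2_convC.
rewrite measure_ofT raddf_sum /= (minn_idPl le_mn).
have -> : `|m - n|%N = (n - m)%N by rewrite distnEr.
rewrite (eq_bigr (fun k : 'I__ => (n - m + 2 * k + 1)%:R
  / ((m + 1)%:R * (n + 1)%:R))); last by move=> k _; rewrite mmapU mulr1.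
rewrite -mulr_suml -natr_sum sum_odd_shift subnKC // natrM divff //.
by rewrite mulf_neq0 // pnatr_eq0 addn1.
Qed.

Lemma chebyshev2_conv0n n : conv 0%N n = << n >>.
Proof.
rewrite /chebyshev2_conv min0n big_ord1 dist0n muln0 addn0 mul1r divff //.
by rewrite pnatr_eq0 addn1.
Qed.

Lemma chebyshev2_one_supp m n : (0%N \in msupp (conv m n)) = (n == m).
Proof.
rewrite -mcoeff_neq0 raddf_sum big_ord_recl /= muln0 addn0 big1 => [|k _].
  rewrite addr0 mcoeffU distn_eq0 [n == m]eq_sym; case: (m == n) => /=.
    by rewrite mulf_neq0 ?invr_neq0 ?mulf_neq0 // pnatr_eq0 addn1.
  by rewrite eqxx.
by rewrite mcoeffU; case: eqP => //; rewrite /bump /=; lia.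
Qed.

Definition chebyshev2 : hypergroup R :=
  @Hypergroup R nat 0%N id conv
    chebyshev2_conv_ge0 chebyshev2_conv_mass1 chebyshev2_convA
    chebyshev2_conv0n
    (fun n => etrans (chebyshev2_convC n 0) (chebyshev2_conv0n n))
    (fun=> erefl)
    (fun m n z => congr1 (mcoeff z) (chebyshev2_convC m n))
    chebyshev2_one_supp.

End Chebyshev2.

(* Main.v *)
Require Import Defs.
From mathcomp Require Import all_boot all_order all_algebra finmap.
From mathcomp Require Import boolp classical_sets.
From mathcomp Require Import reals.
From mathcomp Require Import monalg lra zify.
Import Order.TTheory GRing.Theory Num.Theory.
Local Open Scope ring_scope.

(** For [m <= n] the measure [delta_m * delta_n] lives on the [m + 1] points
    [n - m, n - m + 2, ..., n + m] and gives each of them mass at most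
    [2 / (m + 1)]. Colour [n] by [n / 2 mod r], where [4 / r < alpha]; halving
    turns the support into an interval, so at most [(m + 1) / r + 1] of its
    points share a colour. A sequence of distinct integers has two terms
    [m, n >= r], and for them every colour class has mass at most [4 / r]. *)

(** As an [mmap], the measure of [A] is visibly additive in [f], so it passes through the sum that
    defines a convolution. *)
Lemma measure_ofE (R : realType) (K : choiceType) (f : {malg R[K]})
    (A : set K) :
  measure_of f A = mmap (idfun : R -> R) (fun x => (x \in A)%:R) f.
Proof.
rewrite mmapE /measure_of big_mkcond /=; apply: eq_bigr => x _.
by case: (x \in A); rewrite ?mulr1 ?mulr0.
Qed.

Lemma bilin_extU (R : realType) (K : choiceType) (c : K -> K -> {malg R[K]})
    (x y : K) :
  bilin_ext c << x >> << y >> = c x y.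
Proof.
by rewrite /bilin_ext !msuppU oner_eq0 !big_seq_fset1 !mcoeffUU mulr1 scale1r.
Qed.

Lemma delta_prod2 (R : realType) (K : hypergroup R) (x y : K) :
  delta_prod [:: x; y] = hg_conv x y.
Proof.
by rewrite /delta_prod !big_cons big_nil /mconv !bilin_extU hg_convx1 bilin_extU.
Qed.

Lemma measure_of_chebyshev2_conv (R : realType) (m n : nat) (A : set nat) :
  measure_of (chebyshev2_conv R m n) A =
  \sum_(k < (minn m n).+1 | (`|m - n|%N + 2 * k)%N \in A)
    (`|m - n|%N + 2 * k + 1)%:R / ((m + 1)%:R * (n + 1)%:R).
Proof.
rewrite measure_ofE raddf_sum [RHS]big_mkcond /=; apply: eq_bigr => k _.
by rewrite mmapU /=; case: (_ \in A); rewrite ?mulr1 ?mulr0.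
Qed.

(** Inside one class the quotient [k %/ r] determines [k], and it takes at most [(N %/ r).+1]
    values. *)
Lemma card_residue_class (N r c i : nat) : (0 < r)%N ->
  (#|[pred k : 'I_N | ((c + k) %% r)%N == i]| <= (N %/ r).+1)%N.
Proof.
move=> r0; pose q (k : 'I_N) : 'I_(N %/ r).+1 := inord (k %/ r).
rewrite -[X in (_ <= X)%N]card_ord.
apply: (@leq_card_in _ _ q) => k l; rewrite !inE => /eqP ki /eqP li.
move/(congr1 val); rewrite /= !inordK ?ltnS ?leq_div2r ?(ltnW (ltn_ord _)) //.
move=> eq_q; apply: val_inj => /=.
have/eqP : c + k = c + l %[mod r] by rewrite ki li.
by rewrite eqn_modDl => /eqP eq_r; rewrite (divn_eq k r) eq_q eq_r -divn_eq.
Qed.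

Definition half_residue (r i : nat) : set nat := [set n | (n./2 %% r)%N = i].

Lemma half_residue_partition (r : nat) :
  classical_sets.partition setT
    (fun i : 'I_r.+1 => half_residue r.+1 i) setT.
Proof.
split.
- apply/seteqP; split=> // n _.
  by exists (Ordinal (ltn_pmod n./2 (ltn0Sn r))).
- by move=> i j _ _ [n [ni nj]]; apply: val_inj; rewrite /= -ni nj.
- by move=> i _; exists i.*2; rewrite /half_residue /= doubleK modn_small.
Qed.

Lemma chebyshev2_conv_half_residue_le (R : realType) (r m n i : nat) :
  (0 < r)%N -> (r <= m)%N -> (r <= n)%N ->
  measure_of (chebyshev2_conv R m n) (half_residue r i) <= 4 / r%:R.
Proof.
move=> r0; wlog mn : m n / (m <= n)%N => [hw rm rn|rm _].
  by case/orP: (leq_total m n) => /hw; [|rewrite chebyshev2_convC]; exact.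
rewrite measure_of_chebyshev2_conv (minn_idPl mn) distnEr //.
have m0 : 0 < (m + 1)%:R :> R by rewrite ltr0n addn1.
have n0 : 0 < (n + 1)%:R :> R by rewrite ltr0n addn1.
have r0R : 0 < r%:R :> R by rewrite ltr0n.
pose P := [pred k : 'I_m.+1 | (((n - m)./2 + k) %% r)%N == i].
(* Halving [d + 2 * k] gives [d./2 + k] whatever the parity of [d]. *)
rewrite (eq_bigl P); last first.
  move=> k; rewrite inE mul2n; apply/asboolP/eqP;
    by rewrite /half_residue /= halfD odd_double andbF doubleK.
(* Since [k <= m <= n], the numerator is at most [n + m + 1 <= 2 * (n + 1)]. *)
have wle (k : 'I_m.+1) : P k ->
    (n - m + 2 * k + 1)%:R / ((m + 1)%:R * (n + 1)%:R) <= 2 / (m + 1)%:R :> R.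
  move=> _; rewrite invfM mulrCA mulrC ler_pM2r ?invr_gt0 // ler_pdivrMr //.
  by rewrite -natrM ler_nat; have := ltn_ord k; lia.
apply: le_trans (ler_sum _ wle) _.
rewrite sumr_const -(mulr_natr (_ / _)) ler_pdivlMr //.
rewrite -(mulrA (2 / _)) (mulrAC 2) ler_pdivrMr // -natrM.
have cP := @card_residue_class m.+1 r (n - m)./2 i r0.
(* The rounding term contributes [r], which [r <= m] absorbs into a second [m + 1]. *)
have : (#|P| * r <= 2 * (m + 1))%N.
  apply: leq_trans (leq_mul cP (leqnn r)) _.
  by have := leq_divM m.+1 r; rewrite mulSn; lia.
rewrite -(ler_nat R) (natrM _ 2); lra.
Qed.

(** Pigeonhole: otherwise [M + 1] terms from index [N] on would inject into [M] values. *)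
Lemma injective_nat_unbounded (x : nat -> nat) (N M : nat) : injective x ->
  exists2 n, (N <= n)%N & (M <= x n)%N.
Proof.
move=> xI; apply: contrapT => nex.
have lt_x k : (x (N + k) < M)%N.
  by rewrite ltnNge; apply/negP => Mx; apply: nex; exists (N + k)%N; rewrite ?leq_addr.
pose f (k : 'I_M.+1) : 'I_M := Ordinal (lt_x k).
have fI : injective f.
  by move=> k l /(congr1 val) /= /xI /addnI; exact: val_inj.
by have := leq_card f fI; rewrite !card_ord ltnn.
Qed.

Theorem theorem4p5 (R : realType) (alpha : R)
    (alpha_gt0 : 0 < alpha) (alpha_lt1 : alpha < 1) :
  ~ alpha_Ramsey alpha (chebyshev2 R).
Proof.
move=> ramsey; pose r := Num.bound (4 / alpha).
have r_gt : 4 / alpha < r.+1%:R.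
  apply: lt_le_trans (archi_boundP _) _; first by rewrite divr_ge0 // ltW.
  by rewrite ler_nat.
have [i [x [xI _ xC]]] := ramsey _ _ (half_residue_partition r).
have [a _ ra] := injective_nat_unbounded x 0 r.+1 xI.
(* Searching from [a.+1] makes [[:: a; b]] strictly increasing, so a two-point [F] already gives the
   contradiction. *)
have [b ab rb] := injective_nat_unbounded x a.+1 r.+1 xI.
have := xC [:: a; b] isT; rewrite /= ab => /(_ isT).
rewrite delta_prod2 => alpha_lt.
have := lt_le_trans alpha_lt
  (chebyshev2_conv_half_residue_le R r.+1 _ _ i isT ra rb).
by rewrite ltr_pdivlMr // mulrC -ltr_pdivlMr // ltNge ltW.
Qed.
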